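(* Let $\Gamma$ be a finite abelian group of order $m$ (written additively) and let $H\subseteq\Gamma$ be an aperiodic generating set of $\Gamma$. Fix a probability distribution on $H$ giving every element of $H$ positive probability. For each $n$, let $N=\{1,\dots,n\}$ and let $\omega(x)$, $x\in N$, be i.i.d. $H$-valued random variables with this distribution; for $A\subseteq N$ put $\omega(A)=\sum_{x\in A}\omega(x)$, and for an integer $i$ and $\gamma\in\Gamma$ let $S_\gamma(i)=\{A\subseteq N: |A|=\lfloor n/2\rfloor+i,\ \omega(A)=\gamma\}$ (a random family of sets). Then for every fixed integer $i$ and every $\gamma\in\Gamma$, $$\lim_{n\to\infty}\frac{\mathrm{E}[|S_\gamma(i)|]}{\binom{n}{\lfloor n/2\rfloor+i}}=\frac{1}{m}.$$
   Context: $H$ is aperiodic if the greatest common divisor of the set $L=\{\ell\ge 1:\ \exists\,\eta_1,\dots,\eta_\ell\in H \text{ with } \eta_1+\dots+\eta_\ell=0\}$ equals $1$. *)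

(* Defs.v *)
From HB Require Import structures.
From mathcomp Require Import all_boot all_order all_algebra all_fingroup.
From mathcomp Require Import all_classical all_reals all_analysis.

Set Implicit Arguments.
Unset Strict Implicit.
Unset Printing Implicit Defensive.

Import Order.TTheory GRing.Theory Num.Theory.
Import numFieldNormedType.Exports.

Local Open Scope classical_set_scope.
Local Open Scope ring_scope.

(* The gcd of a possibly infinite set of naturals; it is 0 when L is empty. *)
Definition is_gcd_of (L : set nat) (d : nat) : Prop :=
  (forall l, L l -> (d %| l)%N) /\
  (forall c, (forall l, L l -> (c %| l)%N) -> (c %| d)%N).

Definition zero_sum_lengths (G : finZmodType) (H : {set G}) : set nat :=
  [set l | (1 <= l)%N /\
     exists eta : 'I_l -> G, (forall j, eta j \in H) /\ \sum_(j < l) eta j = 0].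

Definition aperiodic (G : finZmodType) (H : {set G}) : Prop :=
  is_gcd_of (zero_sum_lengths H) 1.

(* <<H>>%g is the subgroup generated by H for the finGroupType structure
   carried by G, whose law is the addition of G. *)
Definition generates (G : finZmodType) (H : {set G}) : Prop :=
  (<<H>>)%g = [set: G]%SET.

(* Only the values of p on H are constrained and used. *)
Definition positive_distribution (R : realType) (G : finType) (H : {set G})
    (p : G -> R) : Prop :=
  (forall h, h \in H -> 0 < p h) /\ \sum_(h in H) p h = 1.

(* G is finite and carries the discrete sigma-algebra, so all its subsets are
   measurable. *)
Definition discrete_rv (d : measure_display) (T : measurableType d)
    (G : finType) (X : T -> G) : Prop :=
  forall B : set G, measurable (X @^-1` B).

Definition mutually_independent (d : measure_display) (T : measurableType d)
    (R : realType) (P : probability T R) (G I : finType) (X : I -> T -> G)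
    : Prop :=
  forall (J : {set I}) (B : I -> set G),
    P (\bigcap_(x in [set` J]) (X x @^-1` B x)) =
    (\prod_(x in J) P (X x @^-1` B x))%E.

Record iid_with_distribution (d : measure_display) (T : measurableType d)
    (R : realType) (P : probability T R) (G : finType) (H : {set G})
    (p : G -> R) (I : finType) (X : I -> T -> G) : Prop := IidWithDistribution {
  iid_rv : forall x, discrete_rv (X x) ;
  iid_valued : forall x t, X x t \in H ;
  iid_law : forall x h, h \in H -> P (X x @^-1` [set h]) = (p h)%:E ;
  iid_indep : mutually_independent P X
}.

(* N is represented by 'I_n; w is a realization of x |-> omega(x). *)
Definition S_family (G : finZmodType) (n : nat) (w : 'I_n -> G) (g : G)
    (i : int) : {set {set 'I_n}} :=
  [set A : {set 'I_n} |
     ((#|A|)%:Z == (n %/ 2)%N%:Z + i) && (\sum_(x in A) w x == g)]%SET.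

(* Binomial coefficient with an integer lower index, 0 when it is negative. *)
Definition binz (n : nat) (k : int) : nat :=
  if k is Posz j then 'C(n, j) else 0%N.

(* Main.v *)
Require Import Defs.
From HB Require Import structures.
From mathcomp Require Import all_boot all_order all_algebra all_fingroup.
From mathcomp Require Import all_classical all_reals all_analysis.
From mathcomp Require Import measurable_realfun zify ring lra.

Set Implicit Arguments.
Unset Strict Implicit.
Unset Printing Implicit Defensive.

Import Order.TTheory GRing.Theory Num.Theory.
Import numFieldNormedType.Exports.

Local Open Scope classical_set_scope.
Local Open Scope ring_scope.

(** By linearity of expectation, E|S_g(i)| is the number of k-subsets of N, for
    k = n/2 + i, times the probability that a sum of k independent steps equals
    g, so the ratio is the k-th convolution power of the step law at g.
    Since H generates the finite group and is aperiodic, some convolution power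
    is everywhere positive; each further application of it contracts the sup
    distance to the uniform law by a fixed factor < 1 (Doeblin). As k tends to
    infinity with n, the ratio tends to 1/m. *)

(** * Additive sets of naturals with gcd 1 *)

(** The least positive gap between two members of [L] divides every member, so it is 1; two
    consecutive members [a], [a.+1] then generate every [n >= a * a]. *)
Lemma cofinite_of_gcd1 (L : set nat) :
  L 0%N -> (forall a b, L a -> L b -> L (a + b)%N) ->
  (forall c, (forall l, L l -> (c %| l)%N) -> c = 1%N) ->
  exists N, forall n, (N <= n)%N -> L n.
Proof.
move=> L0 LD gcdL.
have LM k a : L a -> L (k * a)%N.
  by move=> La; elim: k => [|k IH]; rewrite ?mul0n // mulSn; exact: LD.
have gapL : exists d, (0 < d)%N && `[< exists a, L a /\ L (a + d)%N >].
  have [l Ll l_gt0] : exists2 l, L l & (0 < l)%N.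
    apply: contrapT => noL; have := gcdL 2%N.
    suff all2 : forall l, L l -> (2 %| l)%N by move=> /(_ all2).
    by move=> [|l] // Ll; case: noL; exists l.+1.
  by exists l; rewrite l_gt0; apply/asboolP; exists 0%N.
case: (ex_minnP gapL) => d /andP[d_gt0 /asboolP[a [La Lad]]] dmin.
have d1 : d = 1%N.
  (* Otherwise [l %% d] would be a smaller gap, between [l %/ d * (a + d)] and [l %/ d * a + l]. *)
  apply: gcdL => l Ll; apply: contrapT => /negP; rewrite /dvdn -lt0n => r_gt0.
  have := dmin (l %% d)%N; rewrite r_gt0 /= leqNgt ltn_mod d_gt0 /=.
  suff -> : `[< exists b, L b /\ L (b + l %% d)%N >] by move/(_ isT).
  apply/asboolP; exists (l %/ d * (a + d))%N; split; first exact: LM.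
  have -> : (l %/ d * (a + d) + l %% d = l %/ d * a + l)%N.
    by rewrite mulnDr -addnA -divn_eq.
  by apply: LD => //; exact: LM.
rewrite {}d1 addn1 in Lad.
have [a0|a_gt0] := posnP a.
  by exists 0%N => n _; rewrite -[n]muln1 -[X in (_ * X)%N]/(0.+1) -a0; exact: LM.
(* With quotient q and remainder r of [n] by [a], n = (q - r) a + r (a + 1); the bound on [n] gives
   r < a <= q. *)
exists (a * a)%N => n a2n.
have ra : (n %% a < a)%N by rewrite ltn_mod.
have aq : (a <= n %/ a)%N by rewrite leq_divRL.
have -> : n = ((n %/ a - n %% a) * a + n %% a * a.+1)%N.
  rewrite {1}(divn_eq n a) mulnBl mulnS.
  have : (n %% a * a <= n %/ a * a)%N by rewrite leq_mul2r (leq_trans (ltnW ra) aq) orbT.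
  lia.
by apply: LD; exact: LM.
Qed.

(** * Convolution powers on a finite abelian group *)

Fixpoint convpow (R : pzRingType) (G : finZmodType) (mu : G -> R) (k : nat)
    (g : G) : R :=
  if k is k'.+1 then \sum_h mu h * convpow mu k' (g - h) else (g == 0)%:R.

Section ConvolutionPowers.
Variables (R : realType) (G : finZmodType) (mu : G -> R).
Hypotheses (mu_ge0 : forall h, 0 <= mu h) (mu_sum1 : \sum_h mu h = 1).

Lemma convpow_ge0 k g : 0 <= convpow mu k g.
Proof.
elim: k g => [|k IH] g /=; first by rewrite ler0n.
by apply: sumr_ge0 => h _; rewrite mulr_ge0.
Qed.

Lemma sum_translate (f : G -> R) (a : G) : \sum_g f (g - a) = \sum_g f g.
Proof.
rewrite [RHS](reindex (fun g => g - a)) //=.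
by exists (fun g => g + a) => x _; rewrite ?subrK ?addrK.
Qed.

Lemma sum_reflect (f : G -> R) (a : G) : \sum_g f (a - g) = \sum_g f g.
Proof.
rewrite [RHS](reindex (fun g => a - g)) //=.
by exists (fun g => a - g) => x _; rewrite subKr.
Qed.

Lemma convpow_sum1 k : \sum_g convpow mu k g = 1.
Proof.
elim: k => [|k IH] /=.
  by rewrite (bigD1 0) //= eqxx big1 ?addr0 // => g /negbTE ->.
rewrite exchange_big -[RHS]mu_sum1 /=; apply: eq_bigr => h _.
by rewrite -mulr_sumr (sum_translate (convpow mu k)) IH mulr1.
Qed.

(** The Chapman-Kolmogorov identity for the random walk with step law [mu]. *)
Lemma convpowD k l g :
  convpow mu (k + l) g = \sum_a convpow mu k a * convpow mu l (g - a).
Proof.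
elim: k g => [|k IH] g /=.
  rewrite (bigD1 0) //= eqxx mul1r subr0 big1 ?addr0 // => a /negbTE ->.
  by rewrite mul0r.
under [RHS]eq_bigr do rewrite mulr_suml.
rewrite exchange_big /=; apply: eq_bigr => h _.
rewrite IH mulr_sumr -[RHS](sum_translate _ (- h)) /=.
by apply: eq_bigr => a _; rewrite opprK addrK mulrA opprD addrA addrAC.
Qed.

(** The walk may pass through [a] at time [k]: this one term of [convpowD] is positive and the
    others are nonnegative. *)
Lemma convpow_gt0D k l a b :
  0 < convpow mu k a -> 0 < convpow mu l b -> 0 < convpow mu (k + l) (a + b).
Proof.
move=> ka lb; rewrite convpowD (bigD1 a) //= [a + b - a]addrC addKr.
rewrite ltr_wpDr ?mulr_gt0 //.
by apply: sumr_ge0 => c _; rewrite mulr_ge0 ?convpow_ge0.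
Qed.

Lemma convpow1 g : convpow mu 1 g = mu g.
Proof.
rewrite /= (bigD1 g) //= subrr eqxx mulr1 big1 ?addr0 // => h hg.
by rewrite subr_eq0 eq_sym (negbTE hg) mulr0.
Qed.

Lemma convpow_sum_gt0 l (eta : 'I_l -> G) :
  (forall j, 0 < mu (eta j)) -> 0 < convpow mu l (\sum_(j < l) eta j).
Proof.
elim: l eta => [|l IH] eta eta_gt0; first by rewrite big_ord0 /= eqxx ltr01.
rewrite big_ord_recl; apply: (@convpow_gt0D 1 l); first by rewrite convpow1.
exact: IH.
Qed.

(* Subtracting from the transition kernel its uniform part of weight e does not
   change its action on functions with zero mean. *)
Lemma convpow_contract K e k C :
  (forall g, e <= convpow mu K g) ->
  (forall g, `|convpow mu k g - #|G|%:R^-1| <= C) ->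
  forall g, `|convpow mu (K + k) g - #|G|%:R^-1| <= (1 - #|G|%:R * e) * C.
Proof.
move=> eK kC g; have G_neq0 : #|G|%:R != 0 :> R.
  by rewrite pnatr_eq0 -lt0n; apply/card_gt0P; exists 0.
have -> : convpow mu (K + k) g - #|G|%:R^-1 =
    \sum_a (convpow mu K a - e) * (convpow mu k (g - a) - #|G|%:R^-1).
  under eq_bigr do rewrite mulrBr !mulrBl.
  rewrite !sumrB -convpowD -!mulr_suml -mulr_sumr sum_reflect !convpow_sum1.
  by rewrite sumr_const -[e *+ _]mulr_natr -mulrA divff //; ring.
apply: le_trans (ler_norm_sum _ _ _) _.
have -> : 1 - #|G|%:R * e = \sum_a (convpow mu K a - e).
  by rewrite sumrB convpow_sum1 sumr_const mulr_natl.
rewrite mulr_suml; apply: ler_sum => a _.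
by rewrite normrM ger0_norm ?subr_ge0 // ler_wpM2l ?subr_ge0.
Qed.

(** Each block of [K] steps multiplies the sup distance to the uniform law by at most [rho < 1],
    which gives the geometric bound [rho ^+ (k %/ K)]. *)
Lemma convpow_cvg_uniform K (g : G) :
  (0 < K)%N -> (forall a, 0 < convpow mu K a) ->
  convpow mu k g @[k --> \oo] --> (#|G|%:R^-1 : R).
Proof.
move=> K_gt0 posK.
have G_gt0 : (0 < #|G|)%N by apply/card_gt0P; exists 0.
have GR_gt0 : 0 < #|G|%:R :> R by rewrite ltr0n.
pose e := convpow mu K [arg min_(a < 0 | true) convpow mu K a]%O.
have e_gt0 : 0 < e by exact: posK.
have eK a : e <= convpow mu K a.
  by rewrite /e; case: arg_minP => // b _; apply.
pose rho := 1 - #|G|%:R * e.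
have rho_lt1 : rho < 1 by rewrite /rho ltrBlDr ltrDl mulr_gt0.
(* The minimum [e], summed over [G], is at most the total mass 1. *)
have rho_ge0 : 0 <= rho.
  by rewrite subr_ge0 mulr_natl -sumr_const -(convpow_sum1 K); exact: ler_sum.
have bound k : forall a, `|convpow mu k a - #|G|%:R^-1| <= rho ^+ (k %/ K).
  (* Induction on the number of complete blocks. With none, both values lie in [0, 1], so their
     distance is at most 1. *)
  move: {2}(k %/ K)%N (erefl (k %/ K)%N) => j; elim: j k => [|j IH] k kj a.
    rewrite kj expr0 ler_norml; have := convpow_ge0 k a.
    have : convpow mu k a <= 1.
      rewrite -(convpow_sum1 k) (bigD1 a) //= lerDl.
      by apply: sumr_ge0 => b _; exact: convpow_ge0.
    have : #|G|%:R^-1 <= 1 :> R by rewrite invf_le1 // ler1n.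
    have : 0 <= #|G|%:R^-1 :> R by rewrite invr_ge0 ler0n.
    lra.
  have Kk : (K <= k)%N by rewrite leqNgt; apply/negP => /divn_small; rewrite kj.
  rewrite -(subnKC Kk) divnDl ?dvdnn // divnn K_gt0 add1n exprS.
  apply: convpow_contract => // b; apply: IH.
  by move: kj; rewrite -{1}(subnKC Kk) divnDl ?dvdnn // divnn K_gt0 add1n => -[].
apply/cvgrPdist_le => eps eps_gt0.
have cvgrho : rho ^+ k @[k --> \oo] --> (0 : R).
  by apply: cvg_expr; rewrite ger0_norm.
have /cvgrPdist_le/(_ _ eps_gt0)[N _ Nrho] := cvgrho.
exists (N * K)%N => // k /= Nk; rewrite distrC (le_trans (bound k g)) //.
have := Nrho (k %/ K)%N; rewrite /= sub0r normrN ger0_norm ?exprn_ge0 //.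
by apply; rewrite leq_divRL.
Qed.

(** Aperiodicity makes a return to 0 possible at every large time, and generation makes every
    element reachable at some time; padding with a return to 0 makes these times equal. *)
Lemma convpow_eventually_gt0 (H : {set G}) :
  aperiodic H -> generates H -> (forall h, h \in H -> 0 < mu h) ->
  exists2 K, (0 < K)%N & forall g, 0 < convpow mu K g.
Proof.
move=> [_ aperH] genH mu_gt0.
have [N posN] : exists N, forall n, (N <= n)%N -> 0 < convpow mu n 0.
  apply: (@cofinite_of_gcd1 [set n | 0 < convpow mu n 0]) => /=.
  - by rewrite eqxx ltr01.
  - by move=> a b La Lb; have := convpow_gt0D La Lb; rewrite addr0.
  (* Every zero-sum length is a return time, so a common divisor of the return times divides 1. *)
  move=> c cL; apply/eqP; rewrite -dvdn1; apply: aperH => l [_ [eta [etaH eta0]]].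
  apply: cL => /=; rewrite -eta0; apply: convpow_sum_gt0 => j; exact: mu_gt0.
(* The reachable elements: since [G] is finite, containing 0 and being closed under addition makes
   [S] a subgroup. *)
pose S : {set G} := [set g | `[< exists l, 0 < convpow mu l g >]]%SET.
have groupS : group_set S.
  apply/group_setP; split.
    by rewrite inE; apply/asboolP; exists 0%N; rewrite /= FinRing.zmod1gE eqxx ltr01.
  move=> x y /[!inE] -[k kx] [l ly].
  by exists (k + l)%N; rewrite FinRing.zmodMgE; exact: convpow_gt0D.
have reach g : {l | 0 < convpow mu l g}.
  apply: cid; have : (<<H>> \subset Group groupS)%g.
    rewrite gen_subG; apply/fintype.subsetP => h hH; rewrite inE; apply/asboolP.
    by exists 1%N; rewrite convpow1 mu_gt0.
  by rewrite genH => /fintype.subsetP/(_ g); rewrite !inE; exact.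
pose M := (\max_g sval (reach g))%N.
(* At least [N] steps remain for the return to 0 before the path to [g]; the successor keeps the
   time positive. *)
exists (N + M).+1 => // g; have gM : (sval (reach g) <= M)%N by exact: leq_bigmax.
have NK : (N <= (N + M).+1 - sval (reach g))%N by lia.
have := convpow_gt0D (posN _ NK) (svalP (reach g)).
by rewrite add0r subnK // (leq_trans gM) // leqW // leq_addl.
Qed.

End ConvolutionPowers.

(** * Sums of independent variables *)

Lemma probability_partition (d : measure_display) (T : measurableType d)
    (R : realType) (P : probability T R) (G : finType) (X : T -> G) (E : set T) :
  discrete_rv X -> measurable E ->
  P E = (\sum_(h : G) P (E `&` X @^-1` [set h]))%E.
Proof.
move=> mX mE; rewrite fsbig_seq ?index_enum_uniq // -measure_fin_bigcup //.
- congr (P _); apply/seteqP; split=> t /= => [Et|[h _ []//]].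
  by exists (X t) => //=; rewrite mem_index_enum.
- by apply/trivIsetP => x y _ _ /eqP xy; apply/seteqP; split=> t //= [[_ ->] [_ /xy]].
- by move=> h _; apply: measurableI => //; exact: mX.
Qed.

Section SumOfIndependent.
Variables (d : measure_display) (T : measurableType d) (R : realType).
Variables (P : probability T R) (G : finZmodType) (I : finType).
Variables (X : I -> T -> G) (mu : G -> R).
Hypotheses (mX : forall x, discrete_rv (X x)) (indepX : mutually_independent P X).
Hypothesis lawX : forall x h, P (X x @^-1` [set h]) = (mu h)%:E.

(** Induction along the enumeration of [I]: the preimage is split over the finitely many values of
    the first summand. *)
Lemma discrete_rv_sum (A : {set I}) :
  discrete_rv (fun t => \sum_(x in A) X x t).
Proof.
elim: (index_enum I) => [|x r IH] B.
  have [B0|B0] := pselect (B 0).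
    rewrite (_ : _ @^-1` B = setT) //; apply/seteqP; split=> t //= _.
    by rewrite big_nil.
  rewrite (_ : _ @^-1` B = set0) //; apply/seteqP; split=> t //=.
  by rewrite big_nil.
have [xA|xA] := boolP (x \in A); last first.
  under eq_fun do rewrite big_cons (negbTE xA).
  exact: IH.
under eq_fun do rewrite big_cons xA.
rewrite (_ : _ @^-1` B = \bigcup_(h in [set: G]) (X x @^-1` [set h] `&`
    (fun t => \sum_(y <- r | y \in A) X y t) @^-1` [set k | B (h + k)])).
  by apply: fin_bigcup_measurable => // h _; apply: measurableI; [exact: mX|exact: IH].
by apply/seteqP; split=> t /= => [Bt|[h _ [-> //]]]; exists (X x t).
Qed.

(* Carrying the conditioning on J lets the induction remove the elements of A
   one at a time. *)
Lemma probability_sum_given (A J : {set I}) (b : I -> G) (g : G) :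
  [disjoint A & J]%B ->
  P ([set t | \sum_(x in A) X x t = g] `&`
       \bigcap_(x in [set` J]) X x @^-1` [set b x]) =
  (convpow mu #|A| g * \prod_(x in J) mu (b x))%:E.
Proof.
move: {2}#|A| (erefl #|A|) => k; elim: k A J b g => [|k IH] A J b g Ak AJ.
  rewrite Ak; move/eqP: Ak; rewrite cards_eq0 => /eqP -> /=.
  have PJ : P (\bigcap_(x in [set` J]) X x @^-1` [set b x]) =
      (\prod_(x in J) mu (b x))%:E.
    rewrite (indepX J (fun x => [set b x])) -prodEFin.
    by apply: eq_bigr => x _; exact: lawX.
  have [->|g0] := eqVneq g 0.
    rewrite mul1r -PJ; congr (P _); apply/seteqP.
    by split=> t /= => [[]|Jt]; rewrite ?big_set0.
  rewrite mul0r -[RHS](measure0 P); congr (P _); apply/seteqP.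
  by split=> t //= [] /esym/eqP; rewrite big_set0 (negbTE g0).
have [x xA] : exists x, x \in A by apply/card_gt0P; rewrite Ak.
have xJ : x \notin J by rewrite (disjointFr AJ).
rewrite (probability_partition P (mX x)); last first.
  apply: measurableI; first exact: (discrete_rv_sum A [set g]).
  by apply: fin_bigcap_measurable => // y _; exact: mX.
have Axk : #|A :\ x| = k by move: Ak; rewrite (cardsD1 x) xA => -[].
rewrite Ak /= mulr_suml -sumEFin; apply: eq_bigr => h _.
(* The event that [X x] equals [h] joins the conditioning: [x] moves from [A] to [J], and the target
   drops to [g - h]. *)
pose b' y := if y == x then h else b y.
have -> : mu h * convpow mu k (g - h) * \prod_(y in J) mu (b y) =
    convpow mu #|A :\ x| (g - h) * \prod_(y in x |: J) mu (b' y).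
  rewrite Axk big_setU1 //= /b' eqxx mulrA [mu h * _]mulrC; congr (_ * _).
  by apply: eq_bigr => y yJ; case: eqP yJ xJ => // -> ->.
rewrite -IH //; last first.
  rewrite -finset.setI_eq0; apply/eqP/setP => y; rewrite !inE.
  by case: eqP => //= _; have [/(disjointFr AJ) ->|] := boolP (y \in A).
congr (P _); apply/seteqP; split=> t /=.
  move=> [[sumA Jt] xt]; split.
    by rewrite -sumA (big_setD1 x xA) /= xt [h + _]addrC addrK.
  move=> y /=; rewrite !inE /b' => /orP[/eqP ->|yJ]; first by rewrite eqxx.
  by case: eqP => [->|_] //; exact: Jt.
move=> [sumA Jt]; have xt : X x t = h.
  by have := Jt x; rewrite /= !inE eqxx /b' eqxx; exact.
split=> //; split; first by rewrite (big_setD1 x xA) /= xt sumA addrC subrK.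
move=> y /= yJ; have := Jt y; rewrite /= !inE yJ orbT /b' => /(_ isT).
by case: eqP => // yx; rewrite -yx yJ in xJ.
Qed.

Lemma probability_sum (A : {set I}) (g : G) :
  P [set t | \sum_(x in A) X x t = g] = (convpow mu #|A| g)%:E.
Proof.
have := @probability_sum_given A finset.set0 (fun=> 0) g.
rewrite big_set0 mulr1 => <-; last by rewrite -finset.setI_eq0 finset.setI0.
congr (P _); apply/seteqP; split=> t //= => [|[]//].
by move=> sumA; split=> // x /=; rewrite inE.
Qed.

End SumOfIndependent.

(** * Expected size of the random family *)

(** Linearity of expectation, the cardinal being a sum of indicators over all [A]. *)
Lemma expectation_card_family (d : measure_display) (T : measurableType d)
    (R : realType) (P : probability T R) (U : finType) (S : T -> {set U}) :
  (forall A, measurable [set t | A \in S t]) ->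
  ('E_P[fun t => #|S t|%:R] = \sum_(A : U) P [set t | A \in S t])%E.
Proof.
move=> mS; rewrite unlock.
rewrite (eq_integral
    (fun t => \sum_(A : U) (\1_[set t | A \in S t] t)%:E)%E); last first.
  move=> t _; rewrite sumEFin -sum1_card natr_sum big_mkcond /=; congr EFin.
  apply: eq_bigr => A _; rewrite indicE; case: ifP => AS; first by rewrite mem_set.
  by rewrite memNset //= AS.
rewrite ge0_integral_sum //; first last.
- by move=> A; apply/measurable_EFinP; exact: measurable_indic.
by apply: eq_bigr => A _; rewrite integral_indic // setIT.
Qed.

(** Only sets of size [k] contribute, each with the same probability, and there are ['C(n, k)] of
    them. *)
Lemma expectation_card_S_family (R : realType) (G : finZmodType) (mu : G -> R)
    (n k : nat) (d : measure_display) (T : measurableType d)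
    (P : probability T R) (X : 'I_n -> T -> G) (i : int) (g : G) :
  (forall x, discrete_rv (X x)) -> mutually_independent P X ->
  (forall x h, P (X x @^-1` [set h]) = (mu h)%:E) ->
  (n %/ 2)%N%:Z + i = k%:Z ->
  ('E_P[fun t => #|S_family (fun x => X x t) g i|%:R])%E =
  ('C(n, k)%:R * convpow mu k g)%:E.
Proof.
move=> mX indepX lawX nik.
have S_E (A : {set 'I_n}) :
    [set t | A \in S_family (fun x => X x t) g i] =
    if #|A| == k then [set t | \sum_(x in A) X x t = g] else set0.
  apply/seteqP; split=> t /=; rewrite inE nik eqz_nat.
    by case: ifP => //= _ /eqP.
  by case: ifP => //= _ ->; rewrite eqxx.
rewrite expectation_card_family; last first.
  move=> A; rewrite S_E; case: ifP => // _.
  exact: (discrete_rv_sum mX A [set g]).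
rewrite (eq_bigr (fun A : {set 'I_n} =>
    (if #|A| == k then convpow mu k g else 0)%:E)); last first.
  move=> A _; rewrite S_E; case: eqP => [Ak|_]; last exact: measure0.
  by rewrite (probability_sum mX indepX lawX) Ak.
rewrite sumEFin -big_mkcond /= sumr_const -[n in 'C(n, _)]card_ord.
by rewrite -card_draws cardsE mulr_natl.
Qed.

Theorem theorem1 (R : realType) (G : finZmodType) (m : nat) (hm : #|G| = m)
    (H : {set G}) (aperH : aperiodic H) (genH : generates H)
    (p : G -> R) (hp : positive_distribution H p)
    (d : nat -> measure_display) (T : forall n : nat, measurableType (d n))
    (P : forall n : nat, probability (T n) R)
    (omega : forall n : nat, 'I_n -> T n -> G)
    (iid : forall n : nat, iid_with_distribution (P n) H p (@omega n))
    (i : int) (g : G) :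
  ('E_(P n)[fun t => #|S_family (fun x => @omega n x t) g i|%:R]
     / ((binz n ((n %/ 2)%N%:Z + i))%:R)%:E)%E @[n --> \oo]
    --> ((1 / m%:R : R)%:E : \bar R).
Proof.
(* [p] is arbitrary off [H]; extending by 0 gives the true law on all of [G]. *)
pose mu h := if h \in H then p h else 0.
have [p_gt0 p_sum1] := hp.
have mu_ge0 h : 0 <= mu h by rewrite /mu; case: ifP => // /p_gt0/ltW.
have mu_sum1 : \sum_h mu h = 1 by rewrite -big_mkcond.
have lawE n x h : P n (@omega n x @^-1` [set h]) = (mu h)%:E.
  rewrite /mu; case: ifP => hH; first exact: iid_law (iid n) x h hH.
  rewrite (_ : _ @^-1` _ = set0) ?measure0 //; apply/seteqP; split=> t //= th.
  by have := iid_valued (iid n) x t; rewrite th hH.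
have [K K_gt0 posK] : exists2 K, (0 < K)%N & forall a, 0 < convpow mu K a.
  apply: convpow_eventually_gt0 aperH genH _ => // h hH.
  by rewrite /mu hH p_gt0.
have cvg_mu := convpow_cvg_uniform mu_ge0 mu_sum1 g K_gt0 posK.
pose k n := absz ((n %/ 2)%N%:Z + i).
(* Beyond this threshold the integer index is nonnegative and at most [n], so [absz] does not alter
   it and the binomial is nonzero. *)
have kE n : (2 * absz i + 2 <= n)%N -> (n %/ 2)%N%:Z + i = (k n)%:Z.
  by rewrite /k; lia.
have k_le n : (2 * absz i + 2 <= n)%N -> (k n <= n)%N by rewrite /k; lia.
have cvg_k : k n @[n --> \oo] --> \oo.
  apply/cvgnyPge => A; exists (2 * (absz i + A) + 2)%N => // n /=.
  by rewrite /k; lia.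
have cvg_muk := cvg_comp k (convpow mu ^~ g) cvg_k cvg_mu.
rewrite hm -[_^-1]div1r in cvg_muk.
have cvg_mukE : (convpow mu (k n) g)%:E @[n --> \oo] --> ((1 / m%:R : R)%:E).
  by apply: cvg_EFin cvg_muk; exact: nearW.
apply: cvg_trans cvg_mukE.
apply: near_eq_cvg; exists (2 * absz i + 2)%N => // n /= n_ge.
rewrite (expectation_card_S_family g (iid_rv (iid n)) (iid_indep (iid n))
  (lawE n) (kE n n_ge)).
(* The extended-real inverse of a nonzero real is its real inverse, so the binomials cancel. *)
have C_neq0 : 'C(n, k n)%:R != 0 :> R by rewrite pnatr_eq0 -lt0n bin_gt0 k_le.
by rewrite kE //= inver (negbTE C_neq0) -EFinM mulrAC divff // mul1r.
Qed.
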